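(* Let $D>0$. For every feasible algorithm for the single-product lost sales inventory problem with observable demand over $\mathcal{Y}=[0,D]$ whose initial order-up-to level satisfies $y_1\in(0,D]$, there exist a constant sequence of losses ($\ell_t=\ell$ for all $t\in\mathbb{N}$) and a sequence of positive demands ($d_t>0$ for all $t\in\mathbb{N}$) such that the regret is linear, i.e. $R_T=\Theta(T)$.
   Context: $\mathbb{N}=\{1,2,\dots\}$, $[v]^+=\max\{v,0\}$. Single-product lost sales inventory problem with observable demand over $[0,D]$: demands $d_t\ge0$ and losses $\ell_t:\mathbb{R}\to\mathbb{R}$ are chosen in advance. Losses are always assumed convex with uniformly bounded subgradients on $[0,D]$ (there is $G>0$ with $|g|\le G$ for all $t$, $y\in[0,D]$, $g\in\partial\ell_t(y)$). The inventory starts at $x_1=0$. At each period $t$ the manager picks an order-up-to level $y_t\in[0,D]$ using only past observations, subject to the feasibility constraint $y_t\ge x_t$, suffers $\ell_t(y_t)$, observes $d_t$ and a subgradient $g_t\in\partial\ell_t(y_t)$, and the inventory is updated by $x_{t+1}=[y_t-d_t]^+$. An algorithm is feasible if it always satisfies $y_t\ge x_t$ for all $t\in\mathbb{N}$. The initial level $y_1$ is a fixed number, chosen by the algorithm before any observation. Regret: $R_T=\sum_{t=1}^T\ell_t(y_t)-\inf_{y\in[0,D]}\sum_{t=1}^T\ell_t(y)$. $R_T=\Theta(T)$ means: there exist constants $0<a\le b$ and $T_0\in\mathbb{N}$ such that $aT\le R_T\le bT$ for all $T\ge T_0$. *)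

(* Defs.v *)
From mathcomp Require Export all_boot all_order all_algebra.
From mathcomp Require Export boolp classical_sets set_interval reals convex.
Set Implicit Arguments.
Unset Strict Implicit.
Unset Printing Implicit Defensive.
Export Order.TTheory GRing.Theory Num.Theory.
#[global] Open Scope classical_set_scope.
#[global] Open Scope ring_scope.

(* Periods are t = 1, 2, ...: the value at index 0 of a sequence nat -> R
   (demands, losses, subgradients) is never used. *)

Definition subdifferential (R : realType) (l : R -> R) (y : R) : set R :=
  [set g | forall z : R, l y + g * (z - y) <= l z].

Definition admissible_losses (R : realType) (D : R) (l : nat -> R -> R) : Prop :=
  (forall t : nat, (1 <= t)%N ->
     convex_function (R := R) (E := R^o) [set: R] (l t)) /\
  (exists G : R, 0 < G /\
     forall (t : nat) (y g : R), (1 <= t)%N -> 0 <= y <= D ->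
       subdifferential (l t) y g -> `|g| <= G).

(* A deterministic algorithm maps the observations (d_1, g_1), ...,
   (d_{t-1}, g_{t-1}), in chronological order, to y_t; thus y_1 = A [::]. *)
Definition algorithm (R : realType) : Type := seq (R * R) -> R.

Definition level (R : realType) (A : algorithm R) (d g : nat -> R) (t : nat) : R :=
  A [seq (d s, g s) | s <- iota 1 t.-1].

(* x_1 = 0 and x_{t+1} = [y_t - d_t]^+ *)
Definition inventory (R : realType) (d y : nat -> R) (t : nat) : R :=
  if t is s.+2 then Num.max (y s.+1 - d s.+1) 0 else 0.

Definition subgradient_feedback (R : realType) (l : nat -> R -> R)
    (y g : nat -> R) : Prop :=
  forall t : nat, (1 <= t)%N -> subdifferential (l t) (y t) (g t).

Definition feasible (R : realType) (D : R) (A : algorithm R) : Prop :=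
  forall (l : nat -> R -> R) (d g : nat -> R),
    admissible_losses D l ->
    (forall t : nat, (1 <= t)%N -> 0 <= d t) ->
    subgradient_feedback l (level A d g) g ->
    forall t : nat, (1 <= t)%N ->
      0 <= level A d g t <= D /\ inventory d (level A d g) t <= level A d g t.

Definition regret (R : realType) (D : R) (l : nat -> R -> R) (y : nat -> R)
    (T : nat) : R :=
  \sum_(1 <= t < T.+1) l t (y t) -
  inf [set \sum_(1 <= t < T.+1) l t z | z in `[0, D]].

Definition linear_growth (R : realType) (r : nat -> R) : Prop :=
  exists (a b : R) (T0 : nat), [/\ 0 < a, a <= b, (1 <= T0)%N &
    forall T : nat, (T0 <= T)%N -> a * T%:R <= r T <= b * T%:R].

(* Main.v *)
Require Import Defs.
From mathcomp Require Import lra.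

(* Take the identity as loss and demands d_t = y_1 / 2^(t+1). The total demand
   stays below y_1 / 2, so feasibility keeps every level above y_1 / 2, while
   the best fixed level is 0, with zero cumulative loss. *)

Lemma convex_function_id (R : realType) (A : set R) :
  convex_function (R := R) (E := R^o) A id.
Proof. by move=> t x y _ _; exact: lexx. Qed.

Lemma subdifferential_id (R : realType) (y : R) :
  subdifferential id y = [set 1].
Proof.
apply/seteqP; split => [g /= sg|_ -> z /=]; last by lra.
(* The test point [y + 1] gives [g <= 1], and [y - 1] gives [g >= 1]. *)
by have /= := sg (y + 1); have /= := sg (y - 1); lra.
Qed.

Lemma admissible_losses_id (R : realType) (D : R) :
  admissible_losses D (fun _ : nat => id).
Proof.
split=> [t _|]; first exact: convex_function_id.
exists 1; split=> // t y g _ _.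
by rewrite subdifferential_id => ->; rewrite normr1.
Qed.

(** All these sums are nonnegative, and [z = 0], which lies in the interval as [0 <= D], attains
    0. *)
Lemma inf_sum_id (R : realType) (D : R) (T : nat) : 0 <= D ->
  inf [set \sum_(1 <= t < T.+1) z | z in `[0, D]] = 0.
Proof.
move=> D0.
set S := (X in inf X).
have S0 : S 0 by exists 0; rewrite /= ?in_itv /= ?lexx ?big1.
have lbS : lbound S 0.
  by move=> _ [z /= /[!in_itv] /= /andP[z0 _] <-]; exact: sumr_ge0.
apply/eqP; rewrite eq_le; apply/andP; split.
- by apply: ge_inf => //; exists 0.
- by apply: lb_le_inf => //; exists 0.
Qed.

Lemma regret_id (R : realType) (D : R) (y : nat -> R) (T : nat) : 0 <= D ->
  regret D (fun _ : nat => id) y T = \sum_(1 <= t < T.+1) y t.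
Proof. by move=> D0; rewrite /regret inf_sum_id // subr0. Qed.

(** The lower bound is exactly [y 1] minus the total demand of the first [t] periods, so each step
    of the induction only subtracts one more demand. *)
Lemma level_geometric_demand_ge (R : realType) (y d : nat -> R) :
    (forall t, (1 <= t)%N -> inventory d y t <= y t) ->
    (forall t, (1 <= t)%N -> d t = y 1%N * 2^-1 ^+ t.+1) ->
  forall t, y 1%N / 2 + y 1%N * 2^-1 ^+ t.+1 <= y t.+1.
Proof.
move=> hy hd; elim=> [|t IH]; first by rewrite expr1; lra.
(* Of the maximum defining the inventory, only the branch [y t.+1 - d t.+1] is needed; this demand
   is half of the geometric term in [IH]. *)
apply: le_trans (hy t.+2 isT); rewrite /= le_max; apply/orP; left.
by rewrite hd// exprS; move: IH; lra.
Qed.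

Theorem proposition14 (R : realType) (D : R) (hD : 0 < D) (A : algorithm R)
    (hA : feasible D A) (hy1 : 0 < A [::] <= D) :
  exists (l : R -> R) (d : nat -> R),
    [/\ admissible_losses D (fun _ : nat => l),
        forall t : nat, (1 <= t)%N -> 0 < d t &
        forall g : nat -> R,
          subgradient_feedback (fun _ : nat => l) (level A d g) g ->
          linear_growth (regret D (fun _ : nat => l) (level A d g))].
Proof.
have /andP[y1_gt0 y1_le] := hy1.
pose d t := A [::] * 2^-1 ^+ t.+1.
have d_gt0 t : 0 < d t by rewrite mulr_gt0 // exprn_gt0 // invr_gt0.
exists id, d; split=> [|t _|g hg]; [exact: admissible_losses_id|exact: d_gt0|].
have hy := hA _ _ _ (admissible_losses_id _ D) (fun t _ => ltW (d_gt0 t)) hg.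
have y_ge t : (1 <= t)%N -> A [::] / 2 <= level A d g t.
  case: t => // t _.
  have := level_geometric_demand_ge _ _ _ (fun t ht => (hy t ht).2)
    (fun _ _ => erefl) t.
  by apply: le_trans; rewrite lerDl; have := d_gt0 t; rewrite /d /level /= => /ltW.
(* Every level lies between [A [::] / 2] and [D], so these two constants bound the regret term by
   term from the first period on. *)
exists (A [::] / 2), D, 1%N; split=> // [||T _]; [by lra|by lra|].
rewrite regret_id ?(ltW hD) //.
have sum_cst (c : R) : c * T%:R = \sum_(1 <= t < T.+1) c.
  by rewrite sumr_const_nat subn1 mulr_natr.
rewrite !sum_cst; apply/andP; split; apply: ler_sum_nat => t /andP[t1 _].
- exact: y_ge.
- by have [/andP[_ y_le] _] := hy t t1.
Qed.
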